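(* Let $q$ be a power of an odd prime and let $G=T_U:\mathcal{B}$ be the group of order $q^4$ defined in the context. Then $G$ contains a Paley-type partial difference set, i.e. a $\left(q^4,\frac{q^4-1}{2},\frac{q^4-5}{4},\frac{q^4-1}{4}\right)$-partial difference set.
   Context: A $(v,k,\lambda,\mu)$-partial difference set (PDS) in a finite group $G$ of order $v$ is a subset $D$ with $|D|=k$ such that every nonidentity element of $D$ can be written as $d_1d_2^{-1}$ with $d_1,d_2\in D$ in exactly $\lambda$ ways, and every nonidentity element of $G-D$ in exactly $\mu$ ways. PDSs are assumed regular: $1_G\notin D$ and $D=D^{-1}$. A Paley-type PDS is one with parameters $(v,\frac{v-1}{2},\frac{v-5}{4},\frac{v-1}{4})$. Let $V=\mathbb{F}_q^4$ (row vectors, standard basis $e_1,\dots,e_4$). Elements of $\mathrm{AGL}(4,q)$ are written $[M,u]$ with $M\in\mathrm{GL}(4,q)$, $u\in V$, and product $[M_1,v_1][M_2,v_2]=[M_1M_2,v_1M_2+v_2]$. For $\alpha\in\mathbb{F}_q$ let $$B_\alpha=\begin{pmatrix}1&0&0&0\\0&1&-\alpha&0\\0&0&1&0\\\alpha&0&0&1\end{pmatrix}.$$ Let $U=\langle e_1,e_4\rangle$, $T_U=\{[I,u]:u\in U\}$, $\mathcal{B}=\langle[B_\alpha,\alpha e_2+\beta e_3]:\alpha,\beta\in\mathbb{F}_q\rangle$ and $G=\langle T_U,\mathcal{B}\rangle=T_U:\mathcal{B}$. *)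

(* Defs.v *)
From HB Require Import structures.
From mathcomp Require Import all_boot all_order all_algebra all_fingroup.

Set Implicit Arguments.
Unset Strict Implicit.
Unset Printing Implicit Defensive.

Import GRing.Theory.

Section PartialDifferenceSets.

Local Open Scope group_scope.

Variable gT : finGroupType.

Definition num_quotients (D : {set gT}) (g : gT) : nat :=
  #|[set d : gT * gT in setX D D | d.1 * d.2^-1 == g]|.

(* Regularity (1 \notin D and D = D^-1) is part of the definition. *)
Definition is_pds (v k lambda mu : nat) (G : {group gT}) (D : {set gT}) : Prop :=
  [/\ [/\ #|G| = v, D \subset G & #|D| = k],
      forall g, g \in D -> g != 1 -> num_quotients D g = lambda,
      forall g, g \in G :\: D -> g != 1 -> num_quotients D g = mu,
      1 \notin D
    & D = D^-1].

(* The divisions are exact when v = 1 mod 4 and 5 <= v. *)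
Definition is_paley_pds (v : nat) (G : {group gT}) (D : {set gT}) : Prop :=
  is_pds v ((v - 1) %/ 2) ((v - 5) %/ 4) ((v - 1) %/ 4) G D.

End PartialDifferenceSets.

Section AffineGroup.

Local Open Scope ring_scope.

Variable F : finFieldType.

(* A fresh type: the group law on plain pairs is already the direct product. *)
Inductive AGL4 : predArgType := Agl4 of {'GL_4[F]} * 'rV[F]_4.

Definition agl4_val (x : AGL4) := let: Agl4 p := x in p.

HB.instance Definition _ := [isNew for agl4_val].
HB.instance Definition _ := [Finite of AGL4 by <:].

Definition agl4 (M : {'GL_4[F]}) (u : 'rV[F]_4) : AGL4 := Agl4 (M, u).
Definition agl4_lin (x : AGL4) : {'GL_4[F]} := (agl4_val x).1.
Definition agl4_tr (x : AGL4) : 'rV[F]_4 := (agl4_val x).2.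

Definition agl4_mul (x y : AGL4) : AGL4 :=
  agl4 (agl4_lin x * agl4_lin y)%g
       (agl4_tr x *m GLval (agl4_lin y) + agl4_tr y).
Definition agl4_one : AGL4 := agl4 1%g 0.
Definition agl4_inv (x : AGL4) : AGL4 :=
  agl4 (agl4_lin x)^-1%g
       (- (agl4_tr x *m GLval (agl4_lin x)^-1%g)).

Lemma agl4_mulA : associative agl4_mul.
Proof.
case=> [[M u]] [[N v]] [[P w]]; rewrite /agl4_mul /agl4_lin /agl4_tr /=.
congr (agl4 _ _); first exact: mulgA.
by rewrite mulmxDl -mulmxA addrA.
Qed.

Lemma agl4_mul1 : left_id agl4_one agl4_mul.
Proof.
case=> [[M u]]; rewrite /agl4_mul /agl4_lin /agl4_tr /=.
by rewrite mul0mx add0r mul1g.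
Qed.

Lemma agl4_mulV : left_inverse agl4_one agl4_inv agl4_mul.
Proof.
case=> [[M u]]; rewrite /agl4_mul /agl4_lin /agl4_tr /= mulVg.
congr (agl4 _ _).
have MV : GLval M^-1%g *m GLval M = 1%:M by rewrite -GL_MxE mulVg.
by rewrite mulNmx -mulmxA MV mulmx1 addNr.
Qed.

HB.instance Definition _ :=
  Finite_isGroup.Build AGL4 agl4_mulA agl4_mul1 agl4_mulV.

(* Numbered from 1: e 1, ..., e 4. *)
Definition e (i : nat) : 'rV[F]_4 := \row_(j < 4) (j.+1 == i)%:R.

Definition Bmx (a : F) : 'M[F]_4 :=
  \matrix_(i < 4, j < 4)
    nth 0 (nth [::] [:: [:: 1; 0;   0; 0];
                        [:: 0; 1; - a; 0];
                        [:: 0; 0;   1; 0];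
                        [:: a; 0;   0; 1]] i) j.

Lemma Bmx_mulN a : Bmx a *m Bmx (- a) = 1%:M.
Proof.
apply/matrixP=> i j; rewrite !mxE !big_ord_recl big_ord0 !mxE /=.
case: i => [[|[|[|[|//]]]] ?]; case: j => [[|[|[|[|//]]]] ?];
  by rewrite /= ?(mulr0, mul0r, mulr1, mul1r, addr0, add0r) // ?opprK ?addrN ?addNr.
Qed.

Lemma Bmx_unit a : Bmx a \is a GRing.unit.
Proof. by have [] := mulmx1_unit (Bmx_mulN a). Qed.

Definition BGL (a : F) : {'GL_4[F]} := FinRing.Unit (Bmx_unit a).

Definition U : {vspace 'rV[F]_4} := <<[:: e 1; e 4]>>%VS.

Definition TU : {set AGL4} := [set agl4 1%g u | u : 'rV[F]_4 & u \in U].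

Definition calB : {group AGL4} :=
  <<[set agl4 (BGL x.1) (x.1 *: e 2 + x.2 *: e 3) | x : F * F]>>%G.

Definition grpG : {group AGL4} := <<TU :|: calB>>%G.

End AffineGroup.

(* Main.v *)
Require Import Defs.
From mathcomp Require Import all_boot all_order all_algebra all_fingroup.
From mathcomp Require Import finfield ring lra zify.

Set Implicit Arguments.
Unset Strict Implicit.
Unset Printing Implicit Defensive.

Import Order.TTheory GRing.Theory Num.Theory.

(** The group acts regularly on the vector space of row vectors of length
four, by affine maps, and the set is pulled back from a Paley-type partial
difference set of the additive group that the linear parts preserve. Let q be
the order of the field.

Write a vector as the 2 x 2 matrix with rows (v1, -v3) and (v4, v2). The linear
part [Bmx a] adds a multiple of the second row to the first, so it preserves
the determinant and the row space. On these matrices consider the function f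
([paley_fun]) which is the quadratic character of the determinant at invertible
matrices, a sign depending only on the row space at matrices of rank one, and 0
at the zero matrix; half of the q + 1 possible row spaces have sign 1, half -1.
A set {f = 1}, for f even, zero at the origin and of square 1 elsewhere, is of
Paley type as soon as the convolution f * f is -1 away from the origin
([card_paley], [card_paley_translate]).

To compute f * f, write f = chi + r with chi the character of the determinant
and r the part carried by matrices of rank one. At a nonzero w:
- chi * chi is q - q^2 [det w = 0]: fix the first row u1 of the summation
  matrix. When u1 and the first row w1 of w are independent, the two
  determinants are independent affine functions of the second row and the sum
  vanishes; the rows u1 proportional to w1 leave a product of two Jacobi sums
  ([conv_det]).
- r * chi vanishes: on the matrices with a given row space, the determinant of
  w - u is affine in u, and is zero if it is constant ([conv_ruled_det]).
- r * r is q^2 [det w = 0] - (q + 1): the matrices with row space inside a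
  fixed line form a 2-dimensional subspace, two distinct such subspaces are
  complementary, and the signs add up to zero ([conv_ruled]).
The sum is -1.

The group consists of one element for each vector, with that vector as
translation part ([grpGE]), and f takes the same value at the translation part
of x y^-1 as at the difference of those of x and y ([f_quotient]).
So quotients of two elements of the pulled-back set are counted by f * f. *)

Local Open Scope ring_scope.

(** * The quadratic character of a finite field of odd order *)

Section QuadraticCharacter.

Variable F : finFieldType.
Hypothesis oddF : odd #|F|.

(** Euler's form of the character: multiplicativity then needs no counting of
    squares. *)
Definition qchar (x : F) : int :=
  if x == 0 then 0 else if x ^+ #|F|.-1./2 == 1 then 1 else -1.

Lemma card_gt2 : (2 < #|F|)%N.
Proof. by have := finRing_gt1 F; case: #|F| oddF => [|[|[|]]]. Qed.

Lemma qchar0 : qchar 0 = 0.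
Proof. by rewrite /qchar eqxx. Qed.

Lemma qchar_sqr x : qchar x * qchar x = (x != 0)%:R.
Proof. by rewrite /qchar; case: (x == 0); last by case: ifP. Qed.

(** The square of x^((q - 1) / 2) is x^(q - 1) = 1. *)
Lemma euler_criterion (x : F) :
  x != 0 -> (x ^+ #|F|.-1./2 == 1) || (x ^+ #|F|.-1./2 == -1).
Proof.
move=> x0; rewrite -eqf_sqr expr1n -exprM muln2.
have -> : (#|F|.-1./2.*2 = #|F|.-1)%N.
  by apply: even_halfK; case: #|F| oddF => [|m] /=.
rewrite -(inj_eq (mulfI x0)) -exprS prednK ?expf_card ?mulr1 //.
exact: ltnW (finRing_gt1 F).
Qed.

Lemma qcharM x y : qchar (x * y) = qchar x * qchar y.
Proof.
rewrite /qchar mulf_eq0.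
have [->|x0] := eqVneq x 0; first by rewrite !mul0r.
have [->|y0] := eqVneq y 0; first by rewrite orbT !mulr0.
rewrite /= exprMn.
have [->|x1] := eqVneq (x ^+ _) 1; first by rewrite !mul1r.
have [->|y1] := eqVneq (y ^+ _) 1; first by rewrite !mulr1 (negbTE x1).
have := euler_criterion x0; rewrite (negbTE x1) => /eqP->.
have := euler_criterion y0; rewrite (negbTE y1) => /eqP->.
by rewrite mulrNN mulr1 eqxx.
Qed.

Lemma qchar1 : qchar 1 = 1.
Proof. by rewrite /qchar oner_eq0 expr1n eqxx. Qed.

Lemma qcharN1_sqr : qchar (-1) * qchar (-1) = 1.
Proof. by rewrite -qcharM mulrNN mulr1 qchar1. Qed.

(** A nonzero polynomial of degree (q - 1) / 2 cannot vanish at all the q - 1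
    nonzero elements. *)
Lemma exists_nonsquare : exists2 x : F, x != 0 & qchar x = -1.
Proof.
set h := #|F|.-1./2.
have h0 : (0 < h)%N by rewrite /h; case: #|F| card_gt2 => [|[|[|n]]] //.
suff /existsP[x /andP[x0 xh]] : [exists x : F, (x != 0) && (x ^+ h != 1)].
  by exists x; rewrite // /qchar (negbTE x0) -/h (negbTE xh).
apply/existsPn=> H.
have: (size (enum (predC1 (0%R : F))) <= h)%N.
  apply: (max_unity_roots h0); last exact: enum_uniq.
  apply/allP=> x; rewrite mem_enum inE => x0.
  by have := H x; rewrite x0 negbK unity_rootE.
rewrite -cardE cardC1 leqNgt /h.
by move/negP; apply; have := card_gt2; move: #|F| => k; lia.
Qed.

(** Multiplying the argument by a nonsquare changes the sign of the sum. *)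
Lemma sum_qchar : \sum_x qchar x = 0.
Proof.
have [a a0 ea] := exists_nonsquare.
suff : \sum_x qchar x = - \sum_x qchar x by lra.
rewrite {1}(reindex_inj (mulfI a0)) -sumrN; apply: eq_bigr => x _.
by rewrite qcharM ea mulN1r.
Qed.

Lemma sum_affine (h : F -> int) (a b : F) :
  a != 0 -> \sum_t h (a * t + b) = \sum_t h t.
Proof.
move=> a0; rewrite [RHS](reindex_inj (addIr b)).
by rewrite [RHS](reindex_inj (mulfI a0)).
Qed.

(** A Jacobi sum. For t nonzero, t (m - t) is m / t - 1 times the square t^2,
    and 1 / t runs over all nonzero elements with t, so the sum is that of the
    character over the values of m t - 1 for t nonzero. *)
Lemma sum_qchar_conv m :
  \sum_t qchar t * qchar (m - t) = qchar (-1) * (#|F|%:R * (m == 0)%:R - 1).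
Proof.
transitivity (\sum_(t | t != 0) qchar (m * t - 1)).
  rewrite (bigID (fun t => t == 0)) /= big_pred1_eq qchar0 mul0r add0r.
  rewrite (reindex_inj (inv_inj (@invrK F))); apply: eq_big => t.
    by rewrite invr_eq0.
  rewrite invr_eq0 => t0; rewrite -qcharM.
  have -> : t^-1 * (m - t^-1) = (m * t - 1) * (t^-1 * t^-1) by field.
  by rewrite qcharM [qchar (t^-1 * _)]qcharM qchar_sqr invr_eq0 t0 mulr1.
have [->|m0] := eqVneq m 0.
  rewrite (eq_bigr (fun=> qchar (-1))); last by move=> t _; rewrite mul0r add0r.
  have -> : #|F|%:R = #|F|.-1%:R + 1 :> int.
    by rewrite natr1 prednK // ltnW ?finRing_gt1.
  by rewrite sumr_const cardC1 mulr1 addrK mulr_natr.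
rewrite mulr0 sub0r mulrN1.
have := sum_affine qchar (-1) m0.
rewrite sum_qchar (bigID (fun t => t == 0)) /= big_pred1_eq mulr0 add0r.
by move/eqP; rewrite addr_eq0 => /eqP->; rewrite opprK.
Qed.

End QuadraticCharacter.

(** * The symplectic form of the plane *)

Section Plane.

Variable F : finFieldType.
Implicit Types (r s t : F * F).

Definition wedge r s : F := r.1 * s.2 - r.2 * s.1.
Definition dilate (c : F) r := (c * r.1, c * r.2).

Lemma wedge_pair_inj r s :
  wedge r s != 0 -> injective (fun t => (wedge r t, wedge s t)).
Proof.
case: r s => [a b] [c d]; rewrite /wedge /= => rs0 [x y] [x' y'] /= [].
move=> E1 E2.
(* Cramer's rule for the differences of the coordinates. *)
have Ex : (a * d - b * c) * (x - x') = 0.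
  transitivity (c * ((a * y - b * x) - (a * y' - b * x'))
                - a * ((c * y - d * x) - (c * y' - d * x'))); first by ring.
  by rewrite E1 E2 !subrr !mulr0 subr0.
have Ey : (a * d - b * c) * (y - y') = 0.
  transitivity (d * ((a * y - b * x) - (a * y' - b * x'))
                - b * ((c * y - d * x) - (c * y' - d * x'))); first by ring.
  by rewrite E1 E2 !subrr !mulr0 subr0.
move/eqP: Ex; move/eqP: Ey; rewrite !mulf_eq0 (negbTE rs0) /= !subr_eq0.
by move=> /eqP-> /eqP->.
Qed.

(** Two independent linear forms are coordinates on the plane. *)
Lemma sum_wedge2 r s (h k : F -> int) : wedge r s != 0 ->
  \sum_t h (wedge r t) * k (wedge s t) = (\sum_x h x) * (\sum_x k x).
Proof.
move=> rs0; rewrite big_distrlr /= pair_bigA /=.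
by rewrite [RHS](reindex_inj (wedge_pair_inj rs0)).
Qed.

Lemma exists_wedge_neq0 r : r != (0, 0) -> exists s, wedge r s != 0.
Proof.
case: r => [a b]; rewrite xpair_eqE negb_and /wedge => /orP[a0|b0].
  by exists (0, 1); rewrite /= mulr1 mulr0 subr0.
by exists (1, 0); rewrite /= mulr1 mulr0 sub0r oppr_eq0.
Qed.

(** A nonzero linear form takes each value q times. *)
Lemma sum_wedge r (h : F -> int) : r != (0, 0) ->
  \sum_t h (wedge r t) = #|F|%:R * \sum_x h x.
Proof.
move=> /exists_wedge_neq0[s /(sum_wedge2 h (fun=> 1))].
rewrite sumr_const mulrC => <-.
by apply: eq_bigr => t _; rewrite mulr1.
Qed.

Lemma sum_line s (h : F * F -> int) : s != (0, 0) ->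
  \sum_(r | wedge r s == 0) h r = \sum_c h (dilate c s).
Proof.
case: s => [a b] s0.
(* The factor is read off from a nonzero coordinate of s. *)
pose k := fun r : F * F => if a == 0 then r.2 / b else r.1 / a.
rewrite (reindex_onto (fun c => dilate c (a, b)) k) /=; last first.
  case=> x y; rewrite /wedge /k /dilate /=.
  move: s0; rewrite xpair_eqE negb_and.
  have [->|a0 _] := eqVneq a 0 => /=.
    move=> b0; rewrite mulr0 subr0 mulf_eq0 (negbTE b0) orbF mulr0 => /eqP->.
    by congr (_, _); field.
  rewrite subr_eq0 => /eqP E; congr (_, _); first by field.
  by rewrite mulrAC E mulfK.
apply: eq_bigl => c; rewrite /wedge /k /dilate /=.
move: s0; rewrite xpair_eqE negb_and.
have [->|a0] := eqVneq a 0 => /= b0; by apply/andP; split; apply/eqP; field.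
Qed.

End Plane.

(** * Convolutions on 2 x 2 matrices *)

Lemma sum_pair (A B : finType) (G : A * B -> int) :
  \sum_p G p = \sum_a \sum_b G (a, b).
Proof. by rewrite pair_bigA; apply: eq_bigr => -[]. Qed.

Section Convolutions.

Variable F : finFieldType.
Hypothesis oddF : odd #|F|.
Notation q := (#|F|%:R : int).
Notation V := ((F * F) * (F * F))%type.
Notation v0 := (((0%R, 0%R), (0%R, 0%R)) : V).
Implicit Types (u w : V) (s t : option F).

Definition det u := wedge u.1 u.2.

Definition subp (r s : F * F) := (r.1 - s.1, r.2 - s.2).
Definition subm w u : V := (subp w.1 u.1, subp w.2 u.2).

(** The sum is taken row by row. Unless the first row r of u is proportional to
    that of w, the two determinants are independent affine functions of the
    second row; when r = c w1 they are multiples of t and m - t, for t the value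
    of one linear form and m = det w, which leaves the product of the Jacobi
    sums at 1 and at m. *)
Lemma conv_det_row1 w : w.1 != (0, 0) ->
  \sum_u qchar (det u) * qchar (det (subm w u)) = q - q ^+ 2 * (det w == 0)%:R.
Proof.
case: w => w1 w2 /= w10; rewrite sum_pair /=.
rewrite (bigID (fun r => wedge r w1 == 0)) /=.
rewrite [X in _ + X]big1 ?addr0; last first.
  move=> r rw0.
  have rw : wedge r (subp w1 r) != 0.
    by move: rw0; congr (_ != 0); rewrite /wedge /=; ring.
  have := sum_wedge2 (@qchar F) (fun x => qchar (wedge (subp w1 r) w2 - x)) rw.
  rewrite sum_qchar // mul0r => sum0; rewrite -[RHS]sum0.
  apply: eq_bigr => s _.
  by congr (_ * qchar _); rewrite /det /wedge /=; ring.
rewrite sum_line //.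
transitivity (\sum_(c : F) (qchar c * qchar (1 - c)) *
    (q * \sum_t qchar t * qchar (wedge w1 w2 - t))).
  apply: eq_bigr => c _.
  rewrite -(sum_wedge (fun x => qchar x * qchar (wedge w1 w2 - x)) w10).
  rewrite big_distrr; apply: eq_bigr => s _ /=.
  rewrite -!qcharM //; congr qchar.
  by rewrite /det /wedge /dilate /subp /=; ring.
rewrite -big_distrl !sum_qchar_conv // /= oner_eq0 mulr0 sub0r /det /=.
(* Only the square of the character at -1 survives. *)
have := qcharN1_sqr oddF; set z := qchar _ => zz.
transitivity (z * z * (q - q ^+ 2 * (wedge w1 w2 == 0)%:R)); first by ring.
by rewrite zz mul1r.
Qed.

(** If the first row of w vanishes, exchange the two rows in all matrices: both
    determinants change sign, so the product of their characters does not. *)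
Lemma conv_det w : w != v0 ->
  \sum_u qchar (det u) * qchar (det (subm w u)) = q - q ^+ 2 * (det w == 0)%:R.
Proof.
have [w10 w0|/conv_det_row1//] := eqVneq w.1 (0, 0).
have w20 : w.2 != (0, 0).
  by apply: contraNneq w0 => w20; rewrite [w]surjective_pairing w10 w20.
pose swap u : V := (u.2, u.1).
have swapK : involutive swap by case.
have det_swap u : det (swap u) = - det u by rewrite /det /wedge /=; ring.
rewrite -oppr_eq0 -det_swap -(@conv_det_row1 (swap w)) //.
rewrite (reindex_inj (inv_inj swapK)); apply: eq_bigr => u _.
rewrite det_swap -mulN1r (_ : det (subm w _) = -1 * det (subm (swap w) u)).
  by rewrite !qcharM // mulrACA qcharN1_sqr // mul1r.
by rewrite /det /wedge /=; ring.
Qed.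

(** A representative of each point of the projective line, [None] being the
    point at infinity. *)
Definition dir s : F * F := if s is Some a then (1, a) else (0, 1).

Lemma dir_neq0 s : dir s != (0, 0).
Proof. by case: s => [a|]; rewrite xpair_eqE /= oner_eq0 ?andbF. Qed.

Lemma wedge_dir s t : (wedge (dir s) (dir t) == 0) = (s == t).
Proof.
case: s t => [a|] [b|]; rewrite /wedge /= ?(mulr1, mul1r, mulr0, mul0r) //.
- by rewrite subr_eq0 eq_sym.
- by rewrite subr0 oner_eq0.
- by rewrite sub0r oppr_eq0 oner_eq0.
by rewrite subrr !eqxx.
Qed.

Lemma wedge_dir_line r : r != (0, 0) ->
  exists s, forall t, (wedge r (dir t) == 0) = (t == s).
Proof.
case: r => a b; rewrite xpair_eqE negb_and /wedge.
have [-> /= b0|a0 _] := eqVneq a 0.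
  exists None => -[t|] /=; last by rewrite mulr0 mul0r subr0 !eqxx.
  by rewrite mul0r mulr1 sub0r oppr_eq0 (negbTE b0).
exists (Some (b / a)) => -[t|] /=; last first.
  by rewrite mulr1 mulr0 subr0 (negbTE a0).
rewrite [RHS](_ : _ = (t == b / a)) //; apply/idP/eqP => [|->]; last first.
  by rewrite mulr1 mulrCA mulfV // mulr1 subrr.
by rewrite mulr1 subr_eq0 => /eqP <-; rewrite mulrAC mulfV // mul1r.
Qed.

(** The rows of u lie on the line spanned by [dir s]. For fixed s these matrices
    form a 2-dimensional space of singular matrices: a line of one of the two
    rulings of the quadric det = 0. *)
Definition on_line s u := (wedge u.1 (dir s) == 0) && (wedge u.2 (dir s) == 0).

Lemma sum_on_line s (h : V -> int) :
  \sum_(u | on_line s u) h u =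
  \sum_(x : F * F) h (dilate x.1 (dir s), dilate x.2 (dir s)).
Proof.
transitivity (\sum_(r | wedge r (dir s) == 0)
    \sum_(r' | wedge r' (dir s) == 0) h (r, r')).
  by rewrite pair_big; apply: eq_big => -[].
rewrite sum_line ?dir_neq0 // sum_pair; apply: eq_bigr => c _.
by rewrite sum_line ?dir_neq0.
Qed.

Lemma wedgeC (r r' : F * F) : wedge r r' = - wedge r' r.
Proof. by rewrite /wedge; ring. Qed.

(** If r' and r'' were independent, r would be determined by its products with
    them and hence zero. *)
Lemma wedge_trans (r r' r'' : F * F) :
  r != (0, 0) -> wedge r r' = 0 -> wedge r r'' = 0 -> wedge r' r'' = 0.
Proof.
move=> r0 rr' rr''; apply/eqP; apply: contraNT r0 => nz.
apply/eqP/(wedge_pair_inj nz); rewrite ![wedge _ r]wedgeC rr' rr''.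
by rewrite /wedge /= !mulr0 subrr oppr0.
Qed.

Lemma det_on_line s u : on_line s u -> det u = 0.
Proof.
rewrite /on_line ![wedge _ (dir s)]wedgeC !oppr_eq0.
by move=> /andP[/eqP u1 /eqP u2]; apply: wedge_trans (dir_neq0 s) u1 u2.
Qed.

(** The row space of a matrix of rank one is the line of a nonzero row, and it
    contains the other row because the determinant vanishes. *)
Lemma on_line_singular u : u != v0 -> det u = 0 ->
  exists s, forall t, on_line t u = (t == s).
Proof.
move=> u0 du.
have key r r' : r != (0, 0) -> wedge r r' = 0 -> exists s, forall t,
    (wedge r (dir t) == 0) && (wedge r' (dir t) == 0) = (t == s).
  move=> r0 rr'; have [s rs] := wedge_dir_line r0; exists s => t; rewrite rs.
  have [->|//] := eqVneq t s; apply/eqP/(wedge_trans r0 rr').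
  by apply/eqP; rewrite rs.
have [u1|u1] := eqVneq u.1 (0, 0); last exact: key.
have u2 : u.2 != (0, 0).
  by apply: contraNneq u0 => u2; rewrite [u]surjective_pairing u1 u2.
have [|s us] := key _ u.1 u2; first by rewrite wedgeC -/(det u) du oppr0.
by exists s => t; rewrite -us andbC.
Qed.

Variable eps : option F -> int.
Hypothesis sum_eps : \sum_s eps s = 0.
Hypothesis eps_sqr : forall s, eps s * eps s = 1.

(** On a matrix of rank one this is the sign of its row space; it vanishes on
    invertible matrices, and on the zero matrix because the signs sum to 0. *)
Definition ruled u : int := \sum_s eps s * (on_line s u)%:R.

(** On the matrices u with rows x1 d and x2 d, for a fixed direction d, the
    determinant of w - u is det w minus a linear form in x. If the form is
    nonzero, all values are taken equally often and the character sums to 0. If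
    it is zero then the rows of w are multiples of d as well, so that
    w - u is singular for all these u. *)
Lemma conv_ruled_det w :
  \sum_u ruled u * qchar (det (subm w u)) = 0.
Proof.
transitivity (\sum_s eps s * \sum_(u | on_line s u) qchar (det (subm w u))).
  under eq_bigr do rewrite /ruled big_distrl /=.
  rewrite exchange_big /=; apply: eq_bigr => s _.
  rewrite [in RHS]big_mkcond big_distrr; apply: eq_bigr => u _ /=.
  by case: (on_line s u); rewrite ?mulr1 ?mulr0 ?mul0r.
apply: big1 => s _; apply/eqP; rewrite mulf_eq0; apply/orP; right; apply/eqP.
rewrite sum_on_line; pose p := (wedge w.1 (dir s), wedge w.2 (dir s)).
have E x : det (subm w (dilate x.1 (dir s), dilate x.2 (dir s)))
    = det w - wedge p x.
  by rewrite /p /det /wedge /=; ring.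
under eq_bigr do rewrite E.
have [p0|p0] := eqVneq p (0, 0); last first.
  rewrite (sum_wedge (fun x => qchar (det w - x))) //.
  rewrite (reindex_inj (inv_inj (subKr (det w)))) /=.
  by under eq_bigr do rewrite subKr; rewrite sum_qchar // mulr0.
have ws : on_line s w by case: p0; rewrite /on_line => -> ->; rewrite eqxx.
apply: big1 => x _; rewrite (det_on_line ws) p0.
by rewrite /wedge /= !mul0r !subr0 qchar0.
Qed.

(** For distinct s and t the matrices on the line s and those on the line t
    are complementary subspaces, so w has exactly one decomposition along them;
    for s = t, either all or none of the matrices of the subspace contribute. *)
Lemma meet_lines s t w :
  \sum_(u | on_line s u) (on_line t (subm w u))%:R =
  if s == t then q ^+ 2 * (on_line s w)%:R else 1 :> int.
Proof.
rewrite sum_on_line.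
have E x : on_line t (subm w (dilate x.1 (dir s), dilate x.2 (dir s))) =
  (x.1 * wedge (dir s) (dir t) == wedge w.1 (dir t)) &&
  (x.2 * wedge (dir s) (dir t) == wedge w.2 (dir t)).
  rewrite /on_line; congr (_ && _); rewrite -[RHS]subr_eq0 -[RHS]oppr_eq0;
    congr (_ == 0); rewrite /wedge /=; ring.
under eq_bigr do rewrite E.
have [->|st] := eqVneq s t.
  have -> : wedge (dir t) (dir t) = 0 by apply/eqP; rewrite wedge_dir.
  rewrite (eq_bigr (fun=> (on_line t w)%:R)); last first.
    by move=> x _; rewrite !mulr0 /on_line ![0 == _]eq_sym.
  by rewrite sumr_const card_prod -[LHS]mulr_natl natrM expr2.
have d0 : wedge (dir s) (dir t) != 0 by rewrite wedge_dir.
rewrite (bigD1 (wedge w.1 (dir t) / wedge (dir s) (dir t),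
                wedge w.2 (dir t) / wedge (dir s) (dir t))) //= !divfK // !eqxx.
rewrite big1 ?addr0 // => -[x y] /=; rewrite xpair_eqE.
rewrite -[x == _](inj_eq (mulIf d0)) -[y == _](inj_eq (mulIf d0)).
by rewrite !divfK // => /negbTE->.
Qed.

Lemma sum_lines w : w != v0 ->
  \sum_s (on_line s w)%:R = (det w == 0%R)%:R :> int.
Proof.
move=> w0; have [dw|dw] := eqVneq (det w) 0; last first.
  apply: big1 => s _; case: (boolP (on_line s w)) => // /det_on_line /eqP.
  by rewrite (negbTE dw).
have [s ws] := on_line_singular w0 dw.
by rewrite (bigD1 s) //= ws eqxx big1 ?addr0 // => t; rewrite ws => /negbTE->.
Qed.

(** Because the signs sum to 0, the contribution 1 of a pair of distinct lines
    may be subtracted from every pair; only the diagonal s = t remains. *)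
Lemma conv_ruled w : w != v0 ->
  \sum_u ruled u * ruled (subm w u) = q ^+ 2 * (det w == 0)%:R - (q + 1).
Proof.
move=> w0; transitivity (\sum_s \sum_t eps s * eps t *
    \sum_(u | on_line s u) (on_line t (subm w u))%:R).
  under eq_bigr do rewrite /ruled big_distrlr /=.
  rewrite exchange_big; apply: eq_bigr => s _ /=.
  rewrite exchange_big; apply: eq_bigr => t _ /=.
  rewrite [in RHS]big_mkcond big_distrr; apply: eq_bigr => u _ /=.
  by case: (on_line s u); rewrite ?mulr1 ?mulr0 ?mul0r // mulrA.
transitivity (\sum_s ((q ^+ 2 * (on_line s w)%:R - 1) + eps s * \sum_t eps t)).
  apply: eq_bigr => s _; rewrite big_distrr /=.
  rewrite (bigD1 s) //= [in RHS](bigD1 s) //=.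
  rewrite meet_lines eqxx !eps_sqr mul1r addrA subrK; congr (_ + _).
  by apply: eq_bigr => t ts; rewrite meet_lines eq_sym (negbTE ts) mulr1.
rewrite sum_eps; under eq_bigr do rewrite mulr0 addr0.
rewrite sumrB -big_distrr /= sum_lines // sumr_const card_option.
by rewrite natr1.
Qed.

Definition paley_fun u : int := qchar (det u) + ruled u.

Lemma paley_fun0 : paley_fun v0 = 0.
Proof.
rewrite /paley_fun /ruled /det {1}/wedge /= mulr0 subrr qchar0 add0r.
rewrite -[RHS]sum_eps; apply: eq_bigr => s _.
by rewrite /on_line /wedge /= !mul0r subrr eqxx mulr1.
Qed.

Lemma paley_fun_sqr u : u != v0 -> paley_fun u * paley_fun u = 1.
Proof.
move=> u0; rewrite /paley_fun; have [du|du] := eqVneq (det u) 0.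
  have [s us] := on_line_singular u0 du.
  rewrite du qchar0 add0r /ruled (bigD1 s) //= us eqxx mulr1 big1 ?addr0 //.
  by move=> t; rewrite us => /negbTE->; rewrite mulr0.
have -> : ruled u = 0.
  apply: big1 => s _; case: (boolP (on_line s u)) => [/det_on_line /eqP|_].
    by rewrite (negbTE du).
  by rewrite mulr0.
by rewrite addr0 qchar_sqr du.
Qed.

Lemma paley_fun_opp u : paley_fun (subm v0 u) = paley_fun u.
Proof.
congr (qchar _ + _); first by rewrite /det /wedge /=; ring.
apply: eq_bigr => s _; congr (_ * (_ && _)%:R); rewrite -[RHS]oppr_eq0;
  congr (_ == 0); rewrite /wedge /=; ring.
Qed.

Lemma conv_paley_fun w : w != v0 ->
  \sum_u paley_fun u * paley_fun (subm w u) = -1.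
Proof.
move=> w0.
have subK : involutive (subm w).
  move=> [[a b] [c d]]; case: (w) => [[x y] [z t]].
  by rewrite /subm /subp /= !subKr.
(* The two mixed products are exchanged by the involution u -> w - u. *)
transitivity (\sum_u qchar (det u) * qchar (det (subm w u))
   + \sum_u ruled u * qchar (det (subm w u))
   + \sum_u ruled (subm w u) * qchar (det (subm w (subm w u)))
   + \sum_u ruled u * ruled (subm w u)).
  rewrite -!big_split; apply: eq_bigr => u _ /=; rewrite subK /paley_fun; ring.
have subE : \sum_u ruled (subm w u) * qchar (det (subm w (subm w u))) =
    \sum_u ruled u * qchar (det (subm w u)).
  by rewrite [RHS](reindex_inj (inv_inj subK)).
rewrite subE.
by rewrite conv_det // conv_ruled // !conv_ruled_det; ring.
Qed.

(** Invariance under the linear parts of the group: the row operation changes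
    neither the determinant nor the row space. *)
Lemma paley_fun_shear a u :
  paley_fun ((u.1.1 + a * u.2.1, u.1.2 + a * u.2.2), u.2) = paley_fun u.
Proof.
congr (qchar _ + _); first by rewrite /det /wedge /=; ring.
apply: eq_bigr => s _; congr (_ * (nat_of_bool _)%:R); rewrite /on_line /=.
rewrite andbC [RHS]andbC; case: eqP => //= us; congr (_ == 0).
transitivity (wedge u.1 (dir s) + a * wedge u.2 (dir s)).
  by rewrite /wedge /=; ring.
by rewrite us mulr0 addr0.
Qed.

End Convolutions.

(** The projective line has an even number q + 1 of points. The character gives
    balanced signs to the points other than 0 and infinity, which receive
    opposite signs. *)
Lemma exists_balanced_signs (F : finFieldType) : odd #|F| ->
  exists2 eps : option F -> int,
    \sum_s eps s = 0 & forall s, eps s * eps s = 1.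
Proof.
move=> oddF.
exists (fun s => if s is Some a then qchar a + (a == 0)%:R else -1).
  rewrite (bigD1 None) //=.
  rewrite (reindex_omap Some id) => [|[]] //=.
  under eq_bigl do rewrite eqxx.
  rewrite big_split /= sum_qchar // (bigD1 0) //= eqxx big1 //.
  by move=> a /negbTE->.
case=> [a|]; last by rewrite mulrNN mulr1.
have [->|a0] := eqVneq a 0; first by rewrite qchar0.
by rewrite addr0 qchar_sqr a0.
Qed.

(** * Partial difference sets from even functions *)

Section PaleyFunction.

Variables (V : finZmodType) (f : V -> int).
Hypothesis f0 : f 0 = 0.
Hypothesis f_sqr : forall u, u != 0 -> f u * f u = 1.
Hypothesis f_opp : forall u, f (- u) = f u.
Hypothesis f_conv : forall w, w != 0 -> \sum_u f u * f (w - u) = -1.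

(** The square of the sum of f is the sum of f * f over the whole group, where
    the value |V| - 1 at 0 cancels the values -1 at the other points. *)
Lemma paley_sum0 : \sum_u f u = 0.
Proof.
suff: (\sum_u f u) * (\sum_u f u) = 0.
  by move/eqP; rewrite mulf_eq0 orbb => /eqP.
transitivity (\sum_w \sum_u f u * f (w - u)).
  rewrite big_distrlr exchange_big [RHS]exchange_big /=.
  rewrite [LHS]exchange_big; apply: eq_bigr => u _.
  by rewrite [LHS](reindex_inj (addIr (- u))).
rewrite (bigD1 0) //= [X in _ + X](eq_bigr (fun=> -1)) //.
rewrite (bigD1 0) //= f0 mul0r add0r -big_split big1 // => u u0 /=.
by rewrite sub0r f_opp f_sqr.
Qed.

Lemma paley_indicator u : 2 * (f u == 1)%:R = f u + 1 - (u == 0)%:R.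
Proof.
have [->|u0] := eqVneq u 0; first by rewrite f0.
have /eqP := f_sqr u0; rewrite -expr2 sqrf_eq1 => /orP[] /eqP-> //.
Qed.

Lemma sum_pred1 (w : V) : \sum_u (u == w)%:R = 1%R :> int.
Proof. by rewrite (bigD1 w) //= eqxx big1 // => u /negbTE->. Qed.

Lemma card_paley : (#|[set u | f u == 1%R]|.*2.+1 = #|V|)%N.
Proof.
suff: 2 * (#|[set u | f u == 1%R]|)%:R + 1 = #|V|%:R :> int.
  by rewrite !natz; lia.
rewrite -sum1dep_card natr_sum big_mkcond /= big_distrr /=.
rewrite (eq_bigr (fun u => f u + (1 - (u == 0)%:R))); last first.
  by move=> u _; rewrite addrA -paley_indicator; case: (f u == 1).
by rewrite big_split sumrB /= paley_sum0 sum_pred1 sumr_const add0r subrK.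
Qed.

(** Replace each indicator by its expression in terms of f and expand: the sum
    of f vanishes, and what is left is f * f at w together with values of f. *)
Lemma card_paley_translate w : w != 0 ->
  4 * #|[set u | (f u == 1%R) && (f (w - u) == 1%R)]|%:R
  = #|V|%:R - 3 - 2 * f w :> int.
Proof.
move=> w0; rewrite -sum1dep_card natr_sum big_mkcond /= big_distrr /=.
transitivity (\sum_u (f u * f (w - u) + f u + f (w - u)
   - f u * (u == w)%:R - (u == 0)%:R * f (w - u)
   + (1 - (u == 0)%:R - (u == w)%:R))).
  apply: eq_bigr => u _.
  transitivity ((2 * (f u == 1)%:R) * (2 * (f (w - u) == 1)%:R) : int).
    by case: (f u == 1); case: (f (w - u) == 1).
  have uw : (u == 0)%R%:R * (u == w)%R%:R = 0%R :> int.
    by have [->|u0] := eqVneq u 0; rewrite ?mul0r // eq_sym (negbTE w0).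
  rewrite !paley_indicator subr_eq0 [w == u]eq_sym.
  by rewrite -[LHS]subr0 -uw; ring.
rewrite !(big_split, sumrN, sumrB) /=.
have sumw : \sum_u f (w - u) = 0.
  by rewrite -[RHS]paley_sum0 [RHS](reindex_inj (inv_inj (subKr w))).
have sum1 : \sum_u f u * (u == w)%:R = f w.
  rewrite (bigD1 w) //= eqxx mulr1 big1 ?addr0 // => u /negbTE->.
  by rewrite mulr0.
have sum2 : \sum_u (u == 0)%:R * f (w - u) = f w.
  rewrite (bigD1 0) //= eqxx mul1r subr0 big1 ?addr0 // => u /negbTE->.
  by rewrite mul0r.
rewrite f_conv // sumw sum1 sum2 paley_sum0 !sum_pred1 sumr_const.
by rewrite -[1 *+ _]/(_%:R); ring.
Qed.

End PaleyFunction.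

(** * The affine group and its regular action *)

Section RegularAction.

Variable F : finFieldType.
Implicit Types (u v w : 'rV[F]_4) (a b : F).

Local Notation o0 := (ord0 : 'I_4).
Local Notation o1 := (@Ordinal 4 1 isT).
Local Notation o2 := (@Ordinal 4 2 isT).
Local Notation o3 := (@Ordinal 4 3 isT).

Lemma sum_ord4 (h : 'I_4 -> F) : \sum_i h i = h o0 + h o1 + h o2 + h o3.
Proof.
rewrite !big_ord_recl big_ord0 addr0 !addrA.
by congr (_ + h _ + h _ + h _); apply: val_inj.
Qed.

Lemma row4P u v : u ord0 o0 = v ord0 o0 -> u ord0 o1 = v ord0 o1 ->
  u ord0 o2 = v ord0 o2 -> u ord0 o3 = v ord0 o3 -> u = v.
Proof.
move=> e0 e1 e2 e3; apply/rowP => -[[|[|[|[|//]]]] lt4];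
  [move: e0 | move: e1 | move: e2 | move: e3]; congr (u _ _ = v _ _);
  exact: val_inj.
Qed.

Lemma mulmx_Bmx v a :
  ((v *m Bmx a) ord0 o0 = v ord0 o0 + a * v ord0 o3) *
  ((v *m Bmx a) ord0 o1 = v ord0 o1) *
  ((v *m Bmx a) ord0 o2 = v ord0 o2 - a * v ord0 o1) *
  ((v *m Bmx a) ord0 o3 = v ord0 o3).
Proof. by do !split; rewrite !mxE sum_ord4 !mxE /=; ring. Qed.

Lemma BmxD a b : Bmx a *m Bmx b = Bmx (a + b).
Proof.
apply/row_matrixP => i; rewrite row_mul.
apply: row4P; rewrite mulmx_Bmx !mxE; case: i => [[|[|[|[|//]]]] ?] /=; ring.
Qed.

Lemma Bmx0 : Bmx (0 : F) = 1%:M.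
Proof. by have := Bmx_mulN (0 : F); rewrite BmxD subr0. Qed.

Lemma BGL_D a b : (BGL a * BGL b)%g = BGL (a + b).
Proof. by apply: val_inj; rewrite /= -BmxD. Qed.

Lemma BGL_0 : BGL (0 : F) = 1%g.
Proof. by apply: val_inj; rewrite /= Bmx0. Qed.

(** The element of the group with translation part v: the second coordinate of v
    gives the linear part. *)
Definition elt v : AGL4 F := agl4 (BGL (v ord0 o1)) v.

Lemma elt_tr v : agl4_tr (elt v) = v. Proof. by []. Qed.

Lemma elt_inj : injective elt.
Proof. exact: can_inj elt_tr. Qed.

Lemma elt_mul v w : (elt v * elt w)%g = elt (v *m Bmx (w ord0 o1) + w).
Proof. by rewrite /elt mxE mulmx_Bmx -BGL_D. Qed.

Lemma elt_0 : elt 0 = 1%g.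
Proof. by rewrite /elt mxE BGL_0. Qed.

Lemma elt_group_set : group_set [set elt v | v : 'rV[F]_4].
Proof.
apply/group_setP; split=> [|_ _ /imsetP[v _ ->] /imsetP[w _ ->]].
  by rewrite -elt_0 imset_f.
by rewrite elt_mul imset_f.
Qed.

Lemma elt_linear a b :
  agl4 (BGL a) (a *: e F 2 + b *: e F 3) = elt (a *: e F 2 + b *: e F 3).
Proof. by rewrite /elt !mxE /= mulr1 mulr0 addr0. Qed.

Lemma elt_translation a b :
  agl4 1%g (a *: e F 1 + b *: e F 4) = elt (a *: e F 1 + b *: e F 4).
Proof. by rewrite /elt !mxE /= !mulr0 addr0 BGL_0. Qed.

Lemma mem_U u : reflect (exists a b, u = a *: e F 1 + b *: e F 4) (u \in U F).
Proof.
rewrite /U span_cons span_seq1; apply: (iffP memv_addP).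
  by case=> _ /vlineP[a ->] [_ /vlineP[b ->] ->]; exists a, b.
by case=> a [b ->]; exists (a *: e F 1); rewrite ?memvZ ?memv_line //;
  exists (b *: e F 4); rewrite ?memvZ ?memv_line.
Qed.

(** The elements [elt v] form a subgroup containing the generators; conversely
    [elt v] is a translation along U times a generator of [calB]. *)
Lemma grpGE : grpG F = [set elt v | v : 'rV[F]_4] :> {set AGL4 F}.
Proof.
apply/eqP; rewrite eqEsubset; apply/andP; split.
  suff: grpG F \subset group elt_group_set by [].
  rewrite gen_subG subUset.
  rewrite gen_subG; apply/andP; split; apply/subsetP => x /imsetP[].
    move=> u; rewrite inE => /mem_U[a [b ->]] ->.
    by rewrite elt_translation imset_f.
  by case=> a b _ ->; rewrite elt_linear imset_f.
apply/subsetP => _ /imsetP[v _ ->].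
pose a := v ord0 o1.
(* The translation along U is moved by the linear part of the second factor
   before the translations are added, hence the correction to its e 1 part. *)
pose t := (v ord0 o0 - a * v ord0 o3) *: e F 1 + v ord0 o3 *: e F 4.
pose l := a *: e F 2 + v ord0 o2 *: e F 3.
have -> : elt v = (elt t * elt l)%g.
  rewrite elt_mul; congr elt.
  by apply: row4P; rewrite mxE mulmx_Bmx !mxE /= /a; ring.
apply: groupM; apply: mem_gen; rewrite inE; apply/orP; [left|right].
  rewrite -elt_translation; apply/imsetP; exists t => //.
  by rewrite inE; apply/mem_U; do 2!eexists.
apply: mem_gen; apply/imsetP; exists (a, v ord0 o2) => //.
by rewrite /= elt_linear.
Qed.

Lemma card_grpG : #|grpG F| = (#|F| ^ 4)%N.
Proof. by rewrite grpGE card_imset ?card_mx //; apply: elt_inj. Qed.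

(** With these rows [Bmx a] acts by adding a times the second row to the
    first; the determinant is the quadratic form v1 v2 + v3 v4. *)
Definition rows v : (F * F) * (F * F) :=
  ((v ord0 o0, - v ord0 o2), (v ord0 o3, v ord0 o1)).
Definition of_rows (u : (F * F) * (F * F)) : 'rV[F]_4 :=
  \row_j [:: u.1.1; u.2.2; - u.1.2; u.2.1]`_j.

Lemma rowsK : cancel rows of_rows.
Proof. by move=> v; apply: row4P; rewrite !mxE /= ?opprK. Qed.

Lemma of_rowsK : cancel of_rows rows.
Proof. by move=> [[a b] [c d]]; rewrite /rows !mxE /= opprK. Qed.

Section Pds.

Variable f : 'rV[F]_4 -> int.
Hypothesis f_opp : forall u, f (- u) = f u.
Hypothesis f_B : forall u a, f (u *m Bmx a) = f u.

Definition pds_of : {set AGL4 F} := [set elt u | u in [set u | f u == 1]].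

Lemma mem_pds_of u : (elt u \in pds_of) = (f u == 1).
Proof. by rewrite (mem_imset _ _ elt_inj) inE. Qed.

(** If z = g x^-1 then g = z x, so the translation part of g is that of x plus
    the image of that of z under the linear part of x, which preserves f. *)
Lemma f_quotient g x : g \in grpG F -> x \in grpG F ->
  f (agl4_tr (g * x^-1)%g) = f (agl4_tr g - agl4_tr x).
Proof.
move=> gG xG; set z := (g * x^-1)%g.
have zG : z \in grpG F by rewrite groupM ?groupV.
rewrite (_ : g = (z * x)%g); last by rewrite mulgKV.
move: zG xG; rewrite grpGE => /imsetP[v _ ->] /imsetP[w _ ->].
by rewrite elt_mul !elt_tr addrK f_B.
Qed.

Lemma mem_pds_quotient g x : g \in grpG F -> x \in grpG F ->
  ((g * x^-1)%g \in pds_of) = (f (agl4_tr g - agl4_tr x) == 1).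
Proof.
move=> gG xG; rewrite -f_quotient //.
have : (g * x^-1)%g \in grpG F by rewrite groupM ?groupV.
by rewrite grpGE => /imsetP[v _ ->]; rewrite mem_pds_of.
Qed.

Lemma elt_grpG v : elt v \in grpG F.
Proof. by rewrite grpGE imset_f. Qed.

Lemma mem_pds_inv x : x \in grpG F -> (x^-1%g \in pds_of) = (x \in pds_of).
Proof.
move=> xG; rewrite -[x^-1%g]mul1g mem_pds_quotient ?group1 //.
move: xG; rewrite grpGE => /imsetP[v _ ->].
by rewrite -elt_0 !elt_tr sub0r f_opp mem_pds_of.
Qed.

(** A representation g = d1 d2^-1 is determined by d2. Writing d2 as the inverse
    of [elt u], the condition on d2 becomes f u = 1 and the condition on d1
    becomes f (w - u) = 1, where w is the translation part of g. *)
Lemma num_quotients_pds w : num_quotients pds_of (elt w) =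
  #|[set u | (f u == 1) && (f (w - u) == 1)]|.
Proof.
rewrite /num_quotients.
have inj : injective (fun u => (elt w * (elt u)^-1, (elt u)^-1)%g).
  by move=> u v /(congr1 snd) /invg_inj /elt_inj.
rewrite -(card_imset _ inj); apply: eq_card => -[x y].
rewrite !inE /=; apply/andP/imsetP => [[/andP[xD yD] /eqP xy]|[u]].
  have yG : y \in grpG F.
    by move: yD => /imsetP[v _ ->]; apply: elt_grpG.
  have : y^-1%g \in grpG F by rewrite groupV.
  rewrite grpGE => /imsetP[u _ yu].
  have yE : y = (elt u)^-1%g by rewrite -yu invgK.
  have xE : x = (elt w * (elt u)^-1)%g by rewrite -xy -yu invgK mulgKV.
  exists u; last by rewrite -yE xE yE.
  rewrite inE -mem_pds_of -yu mem_pds_inv // yD.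
  by rewrite -[w]elt_tr -[u]elt_tr -mem_pds_quotient ?elt_grpG // -xE.
rewrite inE => /andP[fu fw] [-> ->].
rewrite mem_pds_inv ?elt_grpG // mem_pds_of fu.
by rewrite mem_pds_quotient ?elt_grpG // fw invgK mulgKV.
Qed.

Hypothesis f0 : f 0 = 0.
Hypothesis f_sqr : forall u, u != 0 -> f u * f u = 1.
Hypothesis f_conv : forall w, w != 0 -> \sum_u f u * f (w - u) = -1.

Lemma pds_of_paley : is_paley_pds (#|F| ^ 4) (grpG F) pds_of.
Proof.
have cardV : #|{: 'rV[F]_4}| = (#|F| ^ 4)%N by rewrite card_mx.
have DG : pds_of \subset grpG F.
  by apply/subsetP => _ /imsetP[u _ ->]; apply: elt_grpG.
have count w : w != 0 ->
    4 * (num_quotients pds_of (elt w))%:R = (#|F| ^ 4)%:R - 3 - 2 * f w :> int.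
  by move=> w0; rewrite num_quotients_pds card_paley_translate // cardV.
split=> [|g gD g1|g|| ].
- split=> //; first exact: card_grpG.
  rewrite card_imset; last exact: elt_inj.
  have := card_paley f0 f_sqr f_opp f_conv; rewrite cardV => <-.
  by rewrite subn1 /= -muln2 mulnK.
- move: gD g1 => /imsetP[w]; rewrite inE => /eqP fw ->.
  rewrite -elt_0 (inj_eq elt_inj) => /count; rewrite fw !natz.
  by move: (num_quotients _ _) (_ ^ _)%N => N v; lia.
- rewrite inE grpGE => /andP[gD /imsetP[w _ gw]].
  move: gD; rewrite gw mem_pds_of => fw.
  rewrite -elt_0 (inj_eq elt_inj) => w0; have := count w w0.
  have /eqP := f_sqr w0; rewrite -expr2 sqrf_eq1 (negbTE fw) !natz => /eqP->.
  by move: (num_quotients _ _) (_ ^ _)%N => N v; lia.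
- by rewrite -elt_0 mem_pds_of f0.
apply/setP => x; rewrite inE; case: (boolP (x \in grpG F)) => xG.
  by rewrite mem_pds_inv.
by rewrite !(contraNF (subsetP DG _)) ?groupV.
Qed.

End Pds.
End RegularAction.

Local Close Scope ring_scope.

Theorem corollary3p13 (p n q : nat) (p_prime : prime p) (p_odd : odd p)
    (n_gt0 : 0 < n) (q_def : q = p ^ n) (F : finFieldType) (cardF : #|F| = q) :
  exists D : {set AGL4 F}, is_paley_pds (q ^ 4) (grpG F) D.
Proof.
have oddF : odd #|F| by rewrite cardF q_def oddX p_odd orbT.
have [eps sum_eps eps_sqr] := exists_balanced_signs oddF.
exists (pds_of (fun u => paley_fun eps (rows u))); rewrite -cardF.
have rows0 : (rows (0 : 'rV[F]_4) = ((0, 0), (0, 0)))%R.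
  by rewrite /rows !mxE oppr0.
have rowsB (u v : 'rV[F]_4) : (rows (u - v) = subm (rows u) (rows v))%R.
  by rewrite /rows /subm /subp /= !mxE !opprD.
have rows_neq0 (u : 'rV[F]_4) : (u != 0 -> rows u != ((0, 0), (0, 0)))%R.
  by rewrite -rows0 (inj_eq (can_inj (@rowsK F))).
apply: pds_of_paley => [u|u a||u u0|w w0].
- by rewrite -sub0r rowsB rows0 paley_fun_opp.
- rewrite -(paley_fun_shear eps a (rows u)); congr paley_fun.
  by rewrite /rows !mulmx_Bmx /= opprD opprK.
- by rewrite rows0 paley_fun0.
- by rewrite paley_fun_sqr ?rows_neq0.
rewrite -(conv_paley_fun oddF sum_eps eps_sqr (rows_neq0 _ w0)).
rewrite [RHS](reindex (@rows F)) /=; last first.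
  by apply: onW_bij; exists (@of_rows F); [apply: rowsK|apply: of_rowsK].
by apply: eq_bigr => u _; rewrite rowsB.
Qed.
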